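(* $H_{\mathrm{even}}\cap(15000,20000]$ is contained in the twenty-seven-element candidate set \[ \begin{aligned} \{ & 15122, 15182, 15206, 15214, 15754, 15758, 16358, 16574, 16778,\\ & 16838, 16922, 17086, 17126, 17162, 17338, 17726, 18134,\\ & 18418, 18934, 18958, 19078, 19226, 19322, 19718, 19802,\\ & 19846, 19862 \}. \end{aligned} \]
   Context: 3-Higgs primes are defined recursively: $2$ is 3-Higgs; an odd prime $p$ is 3-Higgs if and only if every prime factor $q$ of $p-1$ is a 3-Higgs prime (necessarily $q<p$) and satisfies $v_q(p-1)\le 3$ (including $v_2(p-1)\le 3$), where $v_q$ is the $q$-adic valuation. $H$ is the set of integers $m\ge 1$ such that every prime factor of $2^m+1$ is 3-Higgs, and $H_{\mathrm{even}}=H\cap 2\mathbb{Z}$. *)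

(* Defs.v *)
From mathcomp Require Import all_boot.

Set Implicit Arguments.
Unset Strict Implicit.
Unset Printing Implicit Defensive.

(** An inductive predicate expresses the recursion: any prime factor [q] of
    [p.-1] satisfies [q < p], so the least solution of the closure conditions
    is the unique one (see [higgs3_oddE] for the defining equivalence). *)
Inductive higgs3 : nat -> Prop :=
| higgs3_two : higgs3 2
| higgs3_odd (p : nat) :
    prime p -> odd p ->
    (forall q, prime q -> q %| p.-1 -> higgs3 q) ->
    (forall q, prime q -> q %| p.-1 -> logn q p.-1 <= 3) ->
    higgs3 p.

Lemma higgs3_oddE (p : nat) : prime p -> odd p ->
  higgs3 p <->
  (forall q, prime q -> q %| p.-1 -> higgs3 q /\ logn q p.-1 <= 3).
Proof.
move=> p_pr p_odd; split=> [hp | hq]; last first.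
  by apply: higgs3_odd => // q q_pr q_dvd; have [] := hq q q_pr q_dvd.
case: hp p_odd => // r _ _ hr lr _ q q_pr q_dvd.
by split; [apply: hr | apply: lr].
Qed.

Lemma higgs3_prime (p : nat) : higgs3 p -> prime p.
Proof. by case. Qed.

Definition inH (m : nat) : Prop :=
  1 <= m /\ forall p, prime p -> p %| 2 ^ m + 1 -> higgs3 p.

Definition inHeven (m : nat) : Prop := inH m /\ 2 %| m.

(* Main.v *)
Require Import Defs.
From mathcomp Require Import all_boot cyclic.
From Stdlib Require Import NArith.
From mathcomp Require Import zify.

Set Implicit Arguments.
Unset Strict Implicit.
Unset Printing Implicit Defensive.

(** To exclude an exponent [m] it suffices to exhibit a divisor [P > 1] of
    [2 ^ m + 1] none of whose prime factors is 3-Higgs; call such a [P]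
    Higgs-free.  The point of the proof is that Higgs-freeness can be certified
    without factoring [P] or knowing that it is prime, by a variant of
    Pocklington's criterion ([higgs_free_witness]).  Let [p] be a prime factor
    of [P], and let [b ^ F = 1] modulo [P] while [b ^ G - 1] is prime to [P].
    The order of [b] modulo [p] divides [gcd (F, p - 1)] but not [G], so
    [gcd (F, p - 1)] does not divide [G].  A 3-Higgs prime cannot do this when
    [F = q ^ 4] and [G = q ^ 3] with [q] prime, because [q ^ 4] would divide
    [p - 1], nor when [F] is itself Higgs-free and [G = 1], because [p - 1]
    would have a prime factor in common with [F].  Certificates therefore chain:
    each number is certified by a fourth power or by an earlier number.

    Divisors propagate along exponents, since [2 ^ e + 1] divides [2 ^ m + 1]
    whenever [m] is an odd multiple of [e] ([dvdn_exp2_add1]).  The even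
    exponents of the range then fall into three families.  If [8] divides [m],
    then [2 ^ m + 1] itself is Higgs-free, because [2 ^ (m / 8)] has order 16
    modulo each of its prime factors ([notinH_dvd8]).  If [m] is an odd multiple
    of [2 q] with [q] Higgs-free, then [(4 ^ q + 1) / 5] is Higgs-free, because
    [16 ^ q = 1] modulo it ([higgs_free_notinH_double]); this disposes of
    [m = 2 k] as soon as [k] has a prime factor that is not 3-Higgs.  In the
    other cases but one, a known factor of [2 ^ e + 1], with [m] an odd multiple
    of [e], is certified; the exponents congruent to 4 modulo 8 need only the
    factor 17 of [2 ^ 4 + 1].

    The exponent [19066 = 2 * 9533] is left, for which the Aurifeuillian factor
    [L = 2 ^ 9533 + 1 - 2 ^ 4767] of [2 ^ 19066 + 1] is used as a whole
    ([aurifeuille_dvdn]).  If all its prime factors were 3-Higgs, a Higgs-free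
    [r] would be prime to the totient of [L], so that [b ^ r = 1] modulo [L]
    would force [b = 1] modulo [L] ([higgs_free_order_notinH]).  An explicit
    [b] of order [r = 343081] contradicts this.  This variant allows [L] to have
    the 3-Higgs factor 5, and it needs no greatest common divisor of numbers of
    that size; the power is computed with Karatsuba multiplication and with
    reductions that only shift and add.

    The exponents that none of this reaches are the twenty-seven candidates.
    All certificates, and the covering of the range, are verified by computation
    with binary numbers. *)

(** * Numbers without 3-Higgs prime factors *)

(** A pair [(F, G)] as in the criterion below: if [b ^ F = 1] modulo a 3-Higgs
    prime, then already [b ^ G = 1]. *)
Definition obstruction (F G : nat) : Prop :=
  forall p, higgs3 p -> gcdn F p.-1 %| G.

Definition higgs_free (P : nat) : Prop :=
  forall p, higgs3 p -> ~~ (p %| P).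

Lemma higgs3_pred p q : higgs3 p -> prime q -> q %| p.-1 ->
  higgs3 q /\ logn q p.-1 <= 3.
Proof.
move=> hp q_pr; case: hp => [|{}p _ _ hq lq] q_dvd; last by split; auto.
by rewrite dvdn1 in q_dvd; rewrite (eqP q_dvd) in q_pr.
Qed.

Lemma higgs3_pred_gt0 p : higgs3 p -> 0 < p.-1.
Proof. by move/higgs3_prime/prime_gt1; case: p => [|[]]. Qed.

Lemma obstruction_higgs_free P : higgs_free P -> obstruction P 1.
Proof.
move=> freeP p hp; have p_gt0 := higgs3_pred_gt0 hp.
have [|gcd_gt1] := leqP (gcdn P p.-1) 1.
  by rewrite leq_eqVlt ltnS leqn0 eqn0Ngt gcdn_gt0 p_gt0 orbT orbF => /eqP->.
have [q q_pr] := pdivP gcd_gt1; rewrite dvdn_gcd => /andP[qP qp].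
by have [hq _] := higgs3_pred hp q_pr qp; rewrite (negPf (freeP q hq)) in qP.
Qed.

Lemma obstruction_exp4 q : prime q -> obstruction (q ^ 4) (q ^ 3).
Proof.
move=> q_pr p hp.
have /dvdn_pfactor[//|j _ Ej] := dvdn_gcdl (q ^ 4) p.-1.
rewrite Ej; case: j Ej => [|j] Ej; first exact: dvd1n.
have q_dvd : q ^ j.+1 %| p.-1 by rewrite -Ej dvdn_gcdr.
have [_ logq] := higgs3_pred hp q_pr (dvdn_trans (dvdn_exp (ltn0Sn j) (dvdnn q)) q_dvd).
apply: dvdn_exp2l; apply: leq_trans logq.
by rewrite -pfactor_dvdn // higgs3_pred_gt0.
Qed.

(** Bezout's identity in the exponent. *)
Lemma expn_gcd_mod1 b m n d : 0 < m ->
  b ^ m = 1 %[mod d] -> b ^ n = 1 %[mod d] -> b ^ gcdn m n = 1 %[mod d].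
Proof.
move=> m_gt0 bm bn; case: (egcdnP n m_gt0) => u v Euv _.
have : b ^ (u * m) = 1 %[mod d] by rewrite mulnC expnM -modnXm bm modnXm exp1n.
rewrite Euv expnD -modnMml (mulnC v) expnM -[(b ^ n) ^ v %% d]modnXm bn modnXm.
by rewrite exp1n modnMml mul1n.
Qed.

(** Pocklington's argument, applied to all prime factors of [P] at once: were
    [p] a 3-Higgs factor, Fermat's little theorem would give
    [b ^ gcd (F, p - 1) = 1] modulo [p], hence [b ^ G = 1] modulo [p], and [p]
    would divide both [P] and [b ^ G - 1]. *)
Lemma higgs_free_witness P F G b : 0 < F -> obstruction F G ->
  b ^ F = 1 %[mod P] -> coprime P (b ^ G - 1) -> higgs_free P.
Proof.
move=> F_gt0 obsF bF copG p hp; apply/negP => pP.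
have p_pr := higgs3_prime hp; have p_gt1 := prime_gt1 p_pr.
have bFp : b ^ F = 1 %[mod p] by rewrite -(modn_dvdm _ pP) bF modn_dvdm.
have cop_pb : coprime b p.
  rewrite -(coprime_pexpl _ _ F_gt0) -coprime_modl bFp coprime_modl.
  exact: coprime1n.
have bp : b ^ p.-1 = 1 %[mod p].
  by rewrite -[p.-1](totient_prime p_pr) Euler_exp_totient.
have /dvdnP[c Gc] := obsF p hp.
have bG : b ^ G = 1 %[mod p].
  by rewrite Gc mulnC expnM -modnXm expn_gcd_mod1 // modnXm exp1n.
have b_gt0 : 0 < b.
  case: b cop_pb {bF copG bFp bp bG} => //; rewrite /coprime gcd0n.
  by case: p p_gt1 {hp pP p_pr Gc} => [|[]].
have p_bG : p %| b ^ G - 1 by rewrite -eqn_mod_dvd ?expn_gt0 ?b_gt0 //; apply/eqP.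
have : p %| gcdn P (b ^ G - 1) by rewrite dvdn_gcd pP.
by rewrite (eqP copG) dvdn1; case: p p_gt1 {hp pP p_pr Gc bp bG bFp cop_pb p_bG} => [|[]].
Qed.

(** * Excluding exponents *)

(** The identity [x ^ (k + 2) + 1 + (x ^ 2 - 1) = x ^ 2 * (x ^ k + 1)] reduces
    an odd exponent by 2 modulo [x + 1]. *)
Lemma dvdn_exp2_add1 e m : e %| m -> odd (m %/ e) -> 2 ^ e + 1 %| 2 ^ m + 1.
Proof.
move=> /divnK {2}<-; move: (m %/ e) => k k_odd.
rewrite mulnC expnM; have : 0 < 2 ^ e by rewrite expn_gt0.
move: (2 ^ e) => x x_gt0; rewrite -(odd_double_half k) k_odd add1n.
elim: (k./2) => [|i IH]; first by rewrite expn1.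
have x2 : x + 1 %| x ^ 2 - 1 by rewrite -[1 in X in _ %| X](exp1n 2) subn_sqr dvdn_mull.
rewrite -(dvdn_addl _ x2).
have -> : x ^ i.+1.*2.+1 + 1 + (x ^ 2 - 1) = x ^ 2 * (x ^ i.*2.+1 + 1).
  by have := expn_gt0 x 2; rewrite doubleS !expnS; lia.
exact: dvdn_mull.
Qed.

Lemma higgs_free_notinH P m : 1 < P -> higgs_free P -> P %| 2 ^ m + 1 -> ~ inH m.
Proof.
move=> P_gt1 freeP Pm [_ allH]; have [p p_pr pP] := pdivP P_gt1.
by have /negP := freeP p (allH p p_pr (dvdn_trans pP Pm)).
Qed.

(** With [b = 2 ^ (m / 8)] one has [b ^ 8 = -1] modulo [2 ^ m + 1], so
    [b ^ 16 = 1] and [b ^ 8 - 1 = -2] is invertible: all prime factors are 1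
    modulo 16. *)
Lemma notinH_dvd8 m : 8 %| m -> ~ inH m.
Proof.
move=> m8; have x_gt0 : 0 < 2 ^ m by rewrite expn_gt0.
have [m0|m_gt0] := posnP m; first by rewrite m0 => -[].
apply: (@higgs_free_notinH (2 ^ m + 1)) => //; first by rewrite addn1 ltnS.
apply: (@higgs_free_witness _ (2 ^ 4) (2 ^ 3) (2 ^ (m %/ 8))) => //.
- exact: obstruction_exp4.
- rewrite -expnM (mulnA _ 8 2) divnK // expnM.
  have -> : (2 ^ m) ^ 2 = (2 ^ m - 1) * (2 ^ m + 1) + 1.
    by rewrite -subn_sqr exp1n subnK // expn_gt0 x_gt0.
  by rewrite modnMDl.
have -> : 2 ^ m + 1 = (2 ^ m - 1) + 2 by lia.
rewrite -expnM divnK // coprime_sym /coprime gcdnDl -/(coprime _ _) coprimen2.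
by rewrite oddB // oddX gtn_eqF.
Qed.

Lemma higgs3_5 : higgs3 5.
Proof.
apply: higgs3_odd => // q q_pr; rewrite -[5.-1]/(2 ^ 2) (Euclid_dvdX _ _ q_pr) andbT.
  by rewrite dvdn_prime2 // => /eqP->; apply: higgs3_two.
by rewrite dvdn_prime2 // => /eqP->; rewrite pfactorK.
Qed.

(** Take [b = 16], [F = q], [G = 1] and [P = (4 ^ q + 1) / 5].  The division by
    5 makes [P] prime to [b - 1 = 15]: the order of 4 modulo 25 is 10, so
    [25] divides [4 ^ q + 1] only if [5] divides [q], which is impossible since
    5 is a 3-Higgs prime. *)
Lemma higgs_free_notinH_double q m :
  1 < q -> higgs_free q -> 2 * q %| m -> odd (m %/ (2 * q)) -> ~ inH m.
Proof.
move=> q_gt1 freeq q2m odd_m.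
have q_odd : odd q by have := freeq 2 higgs3_two; rewrite dvdn2 negbK.
have nq5 : ~~ (5 %| q) by exact: freeq higgs3_5.
have d5 : 5 %| 4 ^ q + 1.
  have := @dvdn_exp2_add1 2 (2 * q) (dvdn_mulr q (dvdnn 2)).
  by rewrite mulKn // expnM => /(_ q_odd).
have n3 : ~~ (3 %| 4 ^ q + 1) by rewrite /dvdn -modnDml -modnXm exp1n.
have n25 : ~~ (25 %| 4 ^ q + 1).
  rewrite /dvdn -modnDml {1}(divn_eq q 10) expnD (mulnC _ 10) expnM -modnMml -modnXm exp1n.
  have : ~~ (5 %| q %% 10) by rewrite /dvdn modn_dvdm.
  by have := ltn_pmod q (isT : 0 < 10); move: (q %% 10); do 10!case=> //.
have [P Pq] := dvdnP d5.
have P15 : coprime P (3 * 5).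
  rewrite coprimeMr coprime_sym [coprime P 5]coprime_sym !prime_coprime //.
  apply/andP; split; first by apply: contra n3; rewrite Pq => /dvdn_mulr->.
  by apply: contra n25; rewrite Pq => /dvdnP[c ->]; rewrite -mulnA dvdn_mull.
apply: (@higgs_free_notinH P).
- have : 4 ^ 2 <= 4 ^ q by rewrite leq_exp2l.
  by rewrite -(leq_add2r 1) Pq; case: (P) => [|[]].
- apply: (@higgs_free_witness _ q 1 16) => //.
  + exact: ltnW.
  + exact: obstruction_higgs_free.
  + have -> : 16 ^ q = (4 ^ q - 1) * (4 ^ q + 1) + 1.
      by rewrite -subn_sqr exp1n -[16]/(4 ^ 2) -!expnM mulnC subnK // expn_gt0.
    by rewrite Pq mulnA mulnAC modnMDl.
- apply: dvdn_trans (dvdn_exp2_add1 q2m odd_m).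
  by rewrite expnM Pq dvdn_mulr.
Qed.

(** The prime factors of the totient of [P] divide [p] or [p - 1] for some prime
    factor [p] of [P], and those of [p - 1] are 3-Higgs like [p] itself. *)
Lemma coprime_higgs_free_totient r P : 0 < P -> higgs_free r ->
  (forall p, prime p -> p %| P -> higgs3 p) -> coprime r (totient P).
Proof.
move=> P_gt0 freer higgsP; have r_gt0 : 0 < r.
  by case: r freer => // /(_ 2 higgs3_two).
have [|gcd_gt1] := leqP (gcdn r (totient P)) 1.
  by rewrite leq_eqVlt ltnS leqn0 eqn0Ngt gcdn_gt0 r_gt0 orbF.
have [q q_pr] := pdivP gcd_gt1; rewrite dvdn_gcd => /andP[qr].
suff q_higgs : q %| totient P -> higgs3 q.
  by move=> /q_higgs/freer; rewrite qr.
rewrite totientE // big_seq.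
elim/big_ind: _ => [|x y IHx IHy|p]; first by rewrite dvdn1 => /eqP q1; rewrite q1 in q_pr.
  by rewrite Euclid_dvdM // => /orP[/IHx|/IHy].
rewrite mem_primes => /and3P[p_pr _ /(higgsP p p_pr) hp].
rewrite Euclid_dvdM // => /orP[qp|]; first by have [] := higgs3_pred hp q_pr qp.
rewrite Euclid_dvdX // => /andP[].
by rewrite dvdn_prime2 // => /eqP->.
Qed.

Lemma higgs_free_order_notinH r b P m : 0 < P -> higgs_free r ->
  b ^ r = 1 %[mod P] -> b <> 1 %[mod P] -> P %| 2 ^ m + 1 -> ~ inH m.
Proof.
move=> P_gt0 freer br b_neq1 Pm [_ allH]; apply: b_neq1.
have r_gt0 : 0 < r by case: (r) freer => // /(_ 2 higgs3_two).
have cop_r : coprime r (totient P).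
  by apply: coprime_higgs_free_totient => // p p_pr pP; apply: allH => //; apply: dvdn_trans Pm.
have cop_b : coprime b P.
  by rewrite -(coprime_pexpl _ _ r_gt0) -coprime_modl br coprime_modl coprime1n.
have := expn_gcd_mod1 r_gt0 br (Euler_exp_totient cop_b).
by rewrite (eqP cop_r) expn1.
Qed.

(** Aurifeuille's factorisation: for [2 h = k + 1], the number [2 ^ (2 k) + 1]
    is the difference of the squares of [2 ^ k + 1] and [2 ^ h]. *)
Lemma aurifeuille_dvdn k h : k.+1 = h.*2 ->
  2 ^ k + 1 - 2 ^ h %| 2 ^ (2 * k) + 1.
Proof.
move=> kh; apply/dvdnP; exists (2 ^ k + 1 + 2 ^ h).
have -> : 2 ^ (2 * k) + 1 = (2 ^ k + 1) ^ 2 - (2 ^ h) ^ 2.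
  rewrite -expnM muln2 -kh (expnS 2 k) sqrnD exp1n muln1 mulnC expnM.
  by rewrite addnK.
by rewrite subn_sqr mulnC.
Qed.

(** * Certificates on binary numbers *)

Local Open Scope N_scope.

Fixpoint expmod_pos (b : N) (e : positive) (P : N) : N :=
  match e with
  | xH => b mod P
  | xO f => let c := expmod_pos b f P in (c * c) mod P
  | xI f => let c := expmod_pos b f P in (b * ((c * c) mod P)) mod P
  end.

Definition expmod (b e P : N) : N :=
  if e is Npos f then expmod_pos b f P else 1 mod P.

(** A triple [(P, F, b)] claims that [P] is Higgs-free because of the element
    [b], whose order modulo each prime factor of [P] divides [F]. *)
Definition link := (N * N * N)%type.

Definition small_powers : seq (N * N) :=
  [seq (q ^ 4, q ^ 3) | q <- [:: 2; 3; 5; 7; 11; 13]].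

(** The [G] for which [(F, G)] is known to be an obstruction. *)
Definition bound_of (bad : seq N) (F : N) : option N :=
  if has (N.eqb F) bad then Some 1
  else ohead [seq FG.2 | FG <- small_powers & FG.1 =? F].

Definition link_ok (bad : seq N) (s : link) : bool :=
  let: (P, F, b) := s in
  if bound_of bad F is Some G then
    [&& 0 <? F, expmod b F P =? 1 mod P & N.gcd P (expmod b G P - 1) =? 1]
  else false.

(** The links are read in order, so that each may rely on the previous ones. *)
Definition certified (bad : seq N) (ss : seq link) : seq N :=
  foldl (fun acc s => if link_ok acc s then s.1.1 :: acc else acc) bad ss.

Definition root_ok (bad : seq N) (r : N * N) : bool :=
  [&& 1 <? r.2, has (N.eqb r.2) bad & (expmod 2 r.1 r.2 + 1) mod r.2 =? 0].

(** The exponents [e] all of whose odd multiples are excluded.  The bound on [q]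
    merely discards values for which [2 * q] is beyond the range. *)
Definition exponents (bad : seq N) (rs : seq (N * N)) : seq N :=
  sort N.leb ([seq 2 * q | q <- bad & (1 <? q) && (q <? 10000)]
                ++ [seq r.1 | r <- rs & root_ok bad r]).

(** Since [es] is sorted and an odd multiple of [e] other than [e] is at least
    [3 * e], the search can stop early, which keeps the number of divisions
    small; [covered] therefore looks for [m] itself separately. *)
Fixpoint odd_multiple (es : seq N) (m : N) : bool :=
  if es is e :: es' then
    if m <? 3 * e then false
    else if (if m mod e =? 0 then (m / e) mod 2 =? 1 else false) then true
    else odd_multiple es' m
  else false.

Definition covered (es : seq N) (m : N) : bool :=
  if m mod 8 =? 0 then true
  else if odd_multiple es m then true
  else if has (N.eqb m) es then 0 <? m else false.

Fixpoint all_range (f : N -> bool) (x : N) (n : nat) : bool :=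
  if n is n'.+1 then f x && all_range f (N.succ x) n' else true.

Local Close Scope N_scope.

Lemma to_nat_mod x y : N.to_nat (N.modulo x y) = N.to_nat x %% N.to_nat y.
Proof.
have [->|y_neq0] := N.eq_dec y 0; first by case: x.
have := N.mod_lt x y y_neq0; have := N.div_mod x y y_neq0.
move: (N.div x y) (N.modulo x y) => q r -> r_lt.
have -> : N.to_nat (N.add (N.mul y q) r) = N.to_nat q * N.to_nat y + N.to_nat r by lia.
by rewrite modnMDl modn_small //; lia.
Qed.

Lemma to_nat_coprime x y : N.gcd x y = 1%num -> coprime (N.to_nat x) (N.to_nat y).
Proof.
set d := gcdn (N.to_nat x) (N.to_nat y) => gcd1.
have dvd z : d %| N.to_nat z -> N.divide (N.of_nat d) z.
  by move=> /dvdnP[c zE]; exists (N.of_nat c); lia.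
have /N.divide_1_r d1 : N.divide (N.of_nat d) 1.
  by rewrite -gcd1; apply: N.gcd_greatest; apply: dvd; rewrite ?dvdn_gcdl ?dvdn_gcdr.
by apply/eqP; rewrite -/d; lia.
Qed.

Lemma expmodE b e P :
  N.to_nat (expmod b e P) = (N.to_nat b ^ N.to_nat e) %% N.to_nat P.
Proof.
have posE f : N.to_nat (expmod_pos b f P)
    = (N.to_nat b ^ Pos.to_nat f) %% N.to_nat P.
  elim: f => [f IH|f IH|] /=; last by rewrite to_nat_mod expn1.
  - rewrite !(to_nat_mod, N2Nat.inj_mul) IH modnMm modnMmr mulnn -expnM -expnS.
    by congr (_ ^ _ %% _); lia.
  - by rewrite to_nat_mod N2Nat.inj_mul IH modnMm mulnn -expnM; congr (_ ^ _ %% _); lia.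
by case: e => [|f] /=; [rewrite to_nat_mod | exact: posE].
Qed.

Definition sound (bad : seq N) : Prop :=
  forall P, has (N.eqb P) bad -> higgs_free (N.to_nat P).

Lemma bound_ofP bad F G : sound bad -> bound_of bad F = Some G ->
  obstruction (N.to_nat F) (N.to_nat G).
Proof.
move=> bad_ok; rewrite /bound_of; case: ifP => [/bad_ok Fok [<-]|_].
  exact: obstruction_higgs_free.
have small q : prime (N.to_nat q) ->
    obstruction (N.to_nat (q ^ 4)) (N.to_nat (q ^ 3)).
  move=> q_pr; have powE x n : Nat.pow x n = x ^ n.
    by elim: n => //= n ->; rewrite expnS.
  by rewrite !N2Nat.inj_pow !powE; exact: obstruction_exp4.
have : {in small_powers, forall FG, obstruction (N.to_nat FG.1) (N.to_nat FG.2)}.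
  by move=> FG; rewrite /small_powers !inE; do 5?[case/orP=>[/eqP->|]]; last move/eqP->;
   exact: small.
elim: small_powers => [|FG s IH] //= ok_s.
case: N.eqb_spec => [<- [<-]|_]; first by apply: ok_s; rewrite mem_head.
by apply: IH => FG' s_FG'; apply: ok_s; rewrite inE s_FG' orbT.
Qed.

Lemma link_okP bad s : sound bad -> link_ok bad s ->
  higgs_free (N.to_nat s.1.1).
Proof.
move=> bad_ok; case: s => [[P F] b] /=.
case boundF: (bound_of bad F) => [G|//].
move=> /and3P[F_gt0 /N.eqb_spec bF /N.eqb_spec].
move/to_nat_coprime; rewrite N2Nat.inj_sub expmodE => copP.
apply: (@higgs_free_witness _ (N.to_nat F) (N.to_nat G) (N.to_nat b)).
- lia.
- exact: bound_ofP boundF.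
- by rewrite -expmodE bF to_nat_mod.
move: copP; set x := _ ^ _; set p := N.to_nat P.
(* If [p] divides [x], the truncated difference is 0 and the gcd is [p]. *)
have [-> |r_gt0] := posnP (x %% p).
  by rewrite /coprime gcdn0 => /eqP->; rewrite gcd1n.
rewrite {2}(divn_eq x p) -addnBA // /coprime.
by rewrite gcdnMDl.
Qed.

Lemma certified_sound bad ss : sound bad -> sound (certified bad ss).
Proof.
elim: ss bad => //= s ss IH bad bad_ok; apply: IH.
case: ifP => // s_ok P; rewrite /= => /orP[/N.eqb_spec->|]; last exact: bad_ok.
exact: link_okP s_ok.
Qed.

Lemma exponentsP bad rs e m : sound bad -> e \in exponents bad rs ->
  N.to_nat e %| m -> odd (m %/ N.to_nat e) -> ~ inH m.
Proof.
move=> bad_ok; rewrite mem_sort mem_cat => /orP[] /mapP[x].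
  move: x => q; rewrite mem_filter => /andP[/andP[q_gt1 _] q_bad] ->.
  rewrite N2Nat.inj_mul; apply: higgs_free_notinH_double; first by lia.
  by apply: bad_ok; apply/hasP; exists q; rewrite ?N.eqb_refl.
move: x => [r P]; rewrite mem_filter /root_ok /=.
move=> /andP[/and3P[P_gt1 P_bad /N.eqb_spec rP] _] -> em odd_m.
apply: (@higgs_free_notinH (N.to_nat P)); first by lia.
  exact: bad_ok.
apply: dvdn_trans (dvdn_exp2_add1 em odd_m).
move/(congr1 N.to_nat): rP; rewrite to_nat_mod N2Nat.inj_add expmodE modnDml.
by move/eqP.
Qed.

Lemma odd_multipleP es m : odd_multiple es m ->
  exists2 e, e \in es & N.to_nat e %| N.to_nat m
                         /\ odd (N.to_nat m %/ N.to_nat e).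
Proof.
elim: es => //= e es IH.
have later : odd_multiple es m -> exists2 e', e' \in e :: es &
    N.to_nat e' %| N.to_nat m /\ odd (N.to_nat m %/ N.to_nat e').
  by move=> /IH[e' e'_in He']; exists e' => //; rewrite inE e'_in orbT.
case: N.ltb_spec => // _; case: ifP => // em_odd _.
move: em_odd; case: N.eqb_spec => // em0.
have em : N.to_nat e %| N.to_nat m by rewrite /dvdn -to_nat_mod em0.
move=> /N.eqb_spec/(congr1 N.to_nat); rewrite to_nat_mod => odd_quo.
exists e; rewrite ?mem_head //; split=> //.
case: (posnP (N.to_nat e)) em => [e0|e_gt0 /dvdnP[c mE]].
  by move: em0 odd_quo; have -> : e = 0%num by [lia]; case: (m).
move: odd_quo; have -> : m = N.mul (N.of_nat c) e by lia.
rewrite N.div_mul; last by lia.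
by rewrite N2Nat.inj_mul Nat2N.id mulnK // modn2; case: odd.
Qed.

Lemma coveredP bad rs m : sound bad -> covered (exponents bad rs) m ->
  ~ inH (N.to_nat m).
Proof.
move=> bad_ok; rewrite /covered.
case: N.eqb_spec => [m8 _|_].
  by apply: notinH_dvd8; rewrite /dvdn -(to_nat_mod m 8) m8.
case: ifP => [/odd_multipleP[e e_in [em odd_quo]] _|_].
  exact: exponentsP e_in em odd_quo.
case: ifP => // /hasP[e e_in /N.eqb_spec me] m_gt0.
apply: (exponentsP bad_ok e_in); rewrite -me //.
by rewrite divnn (_ : 0 < N.to_nat m) //; lia.
Qed.

Lemma all_rangeP f x n : all_range f x n ->
  forall m, N.to_nat x <= m < N.to_nat x + n -> f (N.of_nat m).
Proof.
elim: n x => [|n IH] x /=; first by move=> _ m; lia.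
case/andP=> fx fn m m_in.
have [mx|mx] := eqVneq m (N.to_nat x); first by rewrite mx N2Nat.id.
by apply: (IH (N.succ x)) => //; lia.
Qed.

(** * Powers modulo an Aurifeuillian factor *)

Local Open Scope N_scope.

(** The quotient and remainder by [2 ^ s], remainder first. *)
Fixpoint split_bits (s : nat) (x : N) : N * N :=
  if s is s'.+1 then
    match x with
    | N0 => (0, 0)
    | Npos xH => (1, 0)
    | Npos (xO y) => let: (l, h) := split_bits s' (Npos y) in (N.double l, h)
    | Npos (xI y) => let: (l, h) := split_bits s' (Npos y) in (N.succ_double l, h)
    end
  else (0, x).

Fixpoint pow2mul (s : nat) (x : N) : N :=
  if s is s'.+1 then N.double (pow2mul s' x) else x.

(** The first argument bounds the depth of the recursion; at the bottom [N.mul]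
    takes over. *)
Fixpoint karatsuba (fuel : nat) (s : nat) (x y : N) : N :=
  if fuel is f.+1 then
    let: (x0, x1) := split_bits s x in
    let: (y0, y1) := split_bits s y in
    let z0 := karatsuba f (uphalf s) x0 y0 in
    let z2 := karatsuba f (uphalf s) x1 y1 in
    let z1 := karatsuba f (uphalf s) (x0 + x1) (y0 + y1) in
    z0 + pow2mul s ((z1 - (z0 + z2)) + pow2mul s z2)
  else x * y.

Lemma pow2mulE s x : pow2mul s x = 2 ^ N.of_nat s * x.
Proof.
elim: s => [|s IH]; first by rewrite N.mul_1_l.
by rewrite [pow2mul _ _]/= IH N.double_spec Nat2N.inj_succ N.pow_succ_r'; lia.
Qed.

Lemma split_bitsE s x : let: (l, h) := split_bits s x in x = l + pow2mul s h.
Proof.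
elim: s x => [|s IH] x //=; case: x => [|[p|p|]] //=.
- by rewrite pow2mulE N.mul_0_r.
- by have := IH (Npos p); case: (split_bits s _) => l h /=; rewrite !pow2mulE; lia.
- by have := IH (Npos p); case: (split_bits s _) => l h /=; rewrite !pow2mulE; lia.
- by rewrite pow2mulE N.mul_0_r.
Qed.

Lemma karatsubaE fuel s x y : karatsuba fuel s x y = x * y.
Proof.
elim: fuel s x y => //= f IH s x y.
have := split_bitsE s x; case: (split_bits s x) => x0 x1 ->.
have := split_bitsE s y; case: (split_bits s y) => y0 y1 ->.
rewrite !IH !pow2mulE; move: (2 ^ _) => B.
have -> : (x0 + x1) * (y0 + y1) - (x0 * y0 + x1 * y1) = x0 * y1 + x1 * y0 by nia.
nia.
Qed.

(** For [2 h = k + 1], reduction modulo [2 ^ k + 1 - 2 ^ h] by means of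
    [2 ^ k = 2 ^ h - 1].  One pass brings a product of [2 k] bits down to about
    [3 k / 2] bits, a second one to a few bits more than [k], and a third one
    absorbs these. *)
Definition aurifeuille_mod (k h : nat) (x : N) : N :=
  let: (l, u) := split_bits k x in (l + pow2mul h u) - u.

Definition aurifeuille_mul (k h : nat) (x y : N) : N :=
  let z := karatsuba 8 (uphalf k) x y in
  aurifeuille_mod k h (aurifeuille_mod k h (aurifeuille_mod k h z)).

Fixpoint aurifeuille_exp (k h : nat) (b : N) (e : positive) : N :=
  match e with
  | xH => b
  | xO f => let c := aurifeuille_exp k h b f in aurifeuille_mul k h c c
  | xI f =>
      let c := aurifeuille_exp k h b f in
      aurifeuille_mul k h b (aurifeuille_mul k h c c)
  end.

Local Close Scope N_scope.

Definition aurifeuille (k h : nat) := 2 ^ k + 1 - 2 ^ h.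

Lemma to_nat_pow2 s : N.to_nat (2 ^ N.of_nat s) = 2 ^ s.
Proof.
by elim: s => // s IH; rewrite Nat2N.inj_succ N.pow_succ_r' N2Nat.inj_mul IH expnS.
Qed.

Lemma aurifeuille_modE k h x : h <= k ->
  N.to_nat (aurifeuille_mod k h x) = N.to_nat x %[mod aurifeuille k h].
Proof.
move=> h_le_k; rewrite /aurifeuille_mod; have := split_bitsE k x.
case: (split_bits k x) => l u ->; rewrite !pow2mulE.
have le2 : 2 ^ h <= 2 ^ k by rewrite leq_exp2l.
have h_gt0 : 0 < 2 ^ h by rewrite expn_gt0.
rewrite N2Nat.inj_sub !N2Nat.inj_add !N2Nat.inj_mul !to_nat_pow2 plusE multE minusE /aurifeuille.
move: (2 ^ h) (2 ^ k) le2 h_gt0 => H K le2 H_gt0.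
have -> : N.to_nat l + K * N.to_nat u =
   N.to_nat u * (K + 1 - H) + (N.to_nat l + H * N.to_nat u - N.to_nat u) by nia.
by rewrite modnMDl.
Qed.

Lemma aurifeuille_mulE k h x y : h <= k ->
  N.to_nat (aurifeuille_mul k h x y) = N.to_nat x * N.to_nat y %[mod aurifeuille k h].
Proof. by move=> hk; rewrite /aurifeuille_mul !aurifeuille_modE // karatsubaE N2Nat.inj_mul. Qed.

Lemma aurifeuille_expE k h b e : h <= k ->
  N.to_nat (aurifeuille_exp k h b e) = N.to_nat b ^ Pos.to_nat e %[mod aurifeuille k h].
Proof.
move=> hk; have sqr_exp c f : N.to_nat c = N.to_nat b ^ f %[mod aurifeuille k h] ->
    N.to_nat (aurifeuille_mul k h c c) = N.to_nat b ^ (f * 2) %[mod aurifeuille k h].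
  by move=> cE; rewrite aurifeuille_mulE // -modnMm cE modnMm mulnn -expnM.
elim: e => [f IH|f IH|] //=.
- rewrite aurifeuille_mulE // -modnMmr (sqr_exp _ _ IH) modnMmr -expnS.
  by congr (_ ^ _ %% _); lia.
- by rewrite (sqr_exp _ _ IH); congr (_ ^ _ %% _); lia.
Qed.

Local Open Scope N_scope.

Definition aurifeuilleN (k h : nat) : N := pow2mul k 1 + 1 - pow2mul h 1.

(** The reduced power is less than twice the modulus, hence the two values that
    represent 1. *)
Definition aurifeuille_ok (k h : nat) (b : N) (r : positive) : bool :=
  let L := aurifeuilleN k h in
  let c := aurifeuille_exp k h b r in
  [&& 1 <? b, b <? L & (if c =? 1 then true else c =? L + 1)].

Local Close Scope N_scope.

Lemma aurifeuilleNE k h : N.to_nat (aurifeuilleN k h) = aurifeuille k h.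
Proof.
by rewrite /aurifeuilleN !pow2mulE !N.mul_1_r N2Nat.inj_sub N2Nat.inj_add !to_nat_pow2.
Qed.

Lemma aurifeuille_notinH k h b r : h <= k -> k.+1 = h.*2 ->
  higgs_free (Pos.to_nat r) -> aurifeuille_ok k h b r -> ~ inH (2 * k).
Proof.
move=> hk kh freer /and3P[b_gt1 b_lt c1].
have L_gt1 : 1 < aurifeuille k h by rewrite -aurifeuilleNE; lia.
apply: (@higgs_free_order_notinH _ (N.to_nat b) (aurifeuille k h)) freer _ _ _.
- exact: ltnW.
- rewrite -aurifeuille_expE //; move: c1; case: N.eqb_spec => [-> //|_ /N.eqb_spec->].
  by rewrite N2Nat.inj_add aurifeuilleNE plusE modnDl.
- by rewrite !modn_small // -?aurifeuilleNE; lia.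
- exact: aurifeuille_dvdn.
Qed.

(** * The tables *)

Local Open Scope N_scope.

(** The witnesses [b] are powers [a ^ ((P - 1) / F)] of small [a], which have
    order dividing [F] when [P] is prime. *)
Definition chain : seq link := [::
  (17, 16, 3); (97, 16, 8); (103, 17, 64); (113, 16, 40); (137, 17, 119);
  (163, 81, 4); (193, 16, 64); (227, 113, 4); (239, 17, 132); (241, 16, 111);
  (257, 16, 249); (307, 17, 273); (337, 16, 191); (353, 16, 304);
  (389, 97, 16); (401, 16, 268); (409, 17, 36); (433, 16, 238); (443, 17, 123);
  (449, 16, 349); (479, 239, 4); (487, 81, 64); (577, 16, 171); (593, 16, 384);
  (613, 17, 586); (619, 103, 64); (641, 16, 601); (647, 17, 293);
  (653, 163, 16); (673, 16, 464); (769, 16, 712); (773, 193, 16);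
  (811, 81, 657); (823, 137, 64); (881, 16, 767); (887, 443, 4);
  (919, 17, 416); (929, 16, 889); (953, 17, 802); (971, 97, 53);
  (977, 16, 620); (1009, 16, 179); (1021, 17, 729); (1031, 103, 1024);
  (1097, 137, 256); (1123, 17, 613); (1153, 16, 1086); (1187, 593, 4);
  (1201, 16, 473); (1217, 16, 737); (1229, 307, 16); (1237, 103, 385);
  (1249, 16, 695); (1259, 17, 316); (1283, 641, 4); (1297, 16, 157);
  (1307, 653, 4); (1327, 17, 165); (1361, 16, 574); (1409, 16, 1254);
  (1531, 17, 502); (1543, 257, 64); (1553, 16, 251); (1583, 113, 554);
  (1601, 16, 257); (1621, 81, 1410); (1637, 409, 16); (1667, 17, 642);
  (1697, 16, 1367); (1733, 433, 16); (1747, 97, 94); (1777, 16, 912);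
  (1783, 81, 688); (1871, 17, 9); (1873, 16, 1496); (1889, 16, 478);
  (1907, 953, 4); (1913, 239, 256); (1931, 193, 1024); (1949, 487, 16);
  (1973, 17, 1948); (2551, 17, 2089); (2593, 16, 25); (2609, 16, 1866);
  (2657, 16, 169); (2659, 443, 64); (2687, 17, 2416); (2689, 16, 250);
  (2693, 673, 16); (2713, 113, 24); (2741, 137, 1514); (2753, 16, 1457);
  (2789, 17, 1057); (2801, 16, 24); (2819, 1409, 4); (2833, 16, 423);
  (2857, 17, 1516); (2897, 16, 1650); (2917, 81, 287); (2939, 113, 2677);
  (3041, 16, 758); (3061, 17, 1004); (3079, 81, 283); (3089, 16, 2380);
  (3121, 16, 436); (3137, 16, 282); (3163, 17, 2929); (3167, 1583, 4);
  (3169, 16, 416); (3203, 1601, 4); (3209, 401, 256); (3217, 16, 279);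
  (3299, 17, 1355); (3313, 16, 2807); (3329, 16, 2699); (3761, 16, 3068);
  (7523, 3761, 4); (7537, 16, 1287); (7549, 17, 798); (3779, 1889, 4);
  (7559, 3779, 4); (7583, 17, 1885); (7649, 16, 4586); (7673, 137, 4934);
  (7681, 16, 7154); (7691, 769, 1024); (7699, 1283, 64); (3863, 1931, 4);
  (7727, 3863, 4); (7753, 17, 946); (7793, 16, 4184); (7817, 977, 256);
  (3911, 17, 555); (7823, 3911, 4); (7829, 103, 3450); (7841, 16, 2276);
  (7873, 16, 6447); (7937, 16, 4334); (7963, 1327, 64); (8017, 16, 6857);
  (8059, 17, 2788); (2017, 16, 1909); (8069, 2017, 16); (8081, 16, 1977);
  (8089, 337, 630); (8093, 17, 2474); (8101, 81, 8057); (8111, 811, 1024);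
  (8161, 16, 5432); (8167, 1361, 64); (8209, 16, 1201); (8221, 137, 4632);
  (8231, 823, 1024); (8263, 81, 3052); (8273, 16, 7745); (8297, 17, 479);
  (8353, 16, 1181); (8363, 113, 3165); (8369, 16, 7112); (8447, 103, 78);
  (8467, 17, 4574); (8501, 17, 6796); (8513, 16, 6602); (8537, 97, 7580);
  (2143, 17, 1812); (8573, 2143, 16); (8597, 307, 2728); (8609, 16, 663);
  (8623, 479, 3454); (8627, 227, 7293); (8641, 16, 7654); (8677, 241, 5557);
  (8689, 16, 5569); (8731, 97, 5222); (8737, 16, 5546); (8753, 16, 4465);
  (8803, 163, 4884); (8807, 17, 4569); (8849, 16, 2231); (8861, 443, 2978);
  (8929, 16, 5574); (4481, 16, 2547); (8963, 4481, 4); (8999, 409, 770);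
  (9011, 17, 5058); (9041, 16, 7263); (9043, 137, 4972); (9059, 647, 7325);
  (9137, 16, 1434); (9181, 17, 2528); (9187, 1531, 64); (9277, 773, 4096);
  (9281, 16, 3192); (9283, 17, 8151); (9319, 1553, 64); (9337, 389, 7964);
  (9377, 16, 5533); (9397, 81, 100); (9419, 17, 5169); (9437, 337, 9428);
  (9473, 16, 7677); (9497, 1187, 256); (9521, 16, 6709); (9601, 16, 187);
  (9623, 17, 7556); (9649, 16, 3462); (9697, 16, 7531); (9719, 113, 169);
  (9721, 81, 7369); (9733, 811, 4096); (4871, 487, 1024); (9743, 4871, 4);
  (9767, 257, 599); (9781, 163, 8386); (9817, 409, 9780); (9833, 1229, 256);
  (2459, 1229, 4); (4919, 2459, 4); (9839, 4919, 4); (9857, 16, 698);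
  (9883, 81, 9703); (4943, 353, 1555); (9887, 4943, 4); (9929, 17, 6287);
  (343081, 953, 336689); (2113, 16, 1099); (525313, 16, 35374);
  (246241, 16, 146035); (107367629, 113, 85379517); (500177, 16, 489046);
  (54001, 16, 46824); (15358129, 16, 3978044); (157649, 16, 23751);
  (148587949, 953, 7849381); (13063537, 16, 1575813);
  (579017791994999956106149, 81, 266497870672552330091435); (26417, 16, 22139);
  (269665073, 16, 26353727); (1408349, 17, 637856); (51473, 16, 9151);
  (11011808951971745915313242336927641, 51473, 340751357485486482655408678914007);
  (37201, 16, 15546); (5080081, 16, 786427); (25212001, 16, 6648813);
  (25367, 1153, 8749); (152203, 25367, 64); (1079423677, 152203, 962274846);
  (18455044087121, 16, 14307920971981); (95768689, 16, 79221725);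
  (151681, 16, 52796); (99972364781, 17, 94246847749); (140617, 81, 61533);
  (3827221, 227, 2134860); (20333, 17, 9733); (12753877, 17, 1326367);
  (21149, 17, 2694); (42569, 17, 11484); (344759057, 16, 201282259);
  (1016929, 16, 864029); (5233, 16, 1767); (65393, 16, 63786);
  (51861618869, 65393, 23260248210); (5575597, 103, 5048428);
  (157661163902833, 16, 32556529786460); (585889, 16, 410164);
  (4353761, 16, 450499); (130612831, 4353761, 28839176);
  (92525303484856757, 130612831, 31199323733936696);
  (6996402304983061, 137, 674083030900962); (111650629, 17, 7041667);
  (25409, 16, 10178); (53633, 16, 1455); (76943, 17, 11379);
  (153887, 76943, 4); (5442059869, 153887, 5290752298); (103837, 17, 58624);
  (16673, 16, 5512); (425654561, 16, 134885858); (1281089, 16, 653497);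
  (4337, 16, 1989); (540893293, 4337, 302382555); (133489553, 16, 88499151);
  (257189, 113, 44405); (2384497, 16, 1438613); (86257, 16, 69527);
  (2322817005065617, 16, 2162601595545224); (1534153, 97, 858159);
  (33613, 2801, 4096); (93405283373, 33613, 78963128908); (11057, 16, 7160);
  (1649929681, 16, 1386217466); (170756297, 17, 164756238);
  (260683037, 239, 40826137); (1567661, 103, 1566175); (41233, 16, 6355);
  (131627, 193, 28057); (12268162909, 131627, 3757701328); (178909, 17, 75018);
  (29153, 16, 6491); (5418991, 3169, 2911407);
  (546289747242387833, 5418991, 8151971865295965);
  (25359946237, 81, 22761632118); (328781, 17, 116593); (47569, 16, 26315);
  (207877, 17, 198908); (622097393, 16, 27140322); (47577889, 16, 28139722);
  (1513441, 16, 417945); (5827, 971, 64); (49459577, 5827, 38807003);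
  (119057, 16, 90055); (28221633169, 16, 10435108939);
  (2070456161, 16, 762726473); (13155349, 17, 1975429); (525029, 17, 13810);
  (75217, 16, 72627); (127489793, 16, 86749908); (19362029, 433, 9426940);
  (668513, 16, 337146); (5702297, 443, 439198); (8392897, 16, 3601875);
  (494425777, 16, 365173465); (26513, 16, 16837); (266081, 16, 196116);
  (603008777268061313, 16, 407019702155659523); (2748917329, 16, 1318010072);
  (85967393, 16, 43767952); (23509, 653, 13219);
  (6923494537, 23509, 1050997460); (734375121419, 17, 511377223895);
  (190937531568941, 734375121419, 88795538368323);
  (1364821475654790269, 190937531568941, 792064320610436817);
  (5796361, 81, 2374973); (23233706849, 16, 2548264992); (29137, 16, 1793);
  (58337, 16, 12332); (46229089, 16, 1602453); (88657, 16, 61427);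
  (1949940913, 16, 1520659668); (762355930500341, 17, 285872715663596);
  (308641, 16, 132303); (46433801, 17, 6194753); (2426269, 103, 1452792);
  (1299437, 163, 321506); (189513197, 137, 73455394);
  (44172232681, 1667, 26160501477); (4910141, 97, 2323030);
  (284369, 16, 38291); (137322001, 16, 130527483); (19698673, 16, 19282717);
  (1931185177, 17, 1335250217); (93460993, 16, 67350373); (125617, 16, 15183);
  (32059409, 16, 11535377); (18486649, 97, 4893923);
  (3321336209, 16, 2680838593); (42737, 16, 4007);
  (39175389329, 16, 13522782670); (30468149, 17, 6615899);
  (25669713977, 241, 21216170937); (62629153, 16, 49854601);
  (86753, 16, 36896); (43014581, 113, 17391140); (370057, 17, 235725);
  (305873, 16, 260451); (236062129, 16, 210317262); (536178193, 16, 209802242);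
  (2288249, 103, 152241); (173628041, 7793, 149352958);
  (14647169, 16, 3193003); (2161, 16, 227); (24229133, 2161, 14571455);
  (346636009, 1697, 194447010); (6743809, 16, 5692624);
  (126838961, 16, 35168607); (3845497, 163, 3740171); (566977, 16, 427689);
  (8054869, 227, 6885891); (896781581, 409, 555773406); (95009, 16, 73618);
  (12955681, 16, 12461477); (48017, 16, 4377);
  (7220236266209, 16, 6616766372264); (290209, 16, 242308);
  (2822832898049, 16, 1404900410943); (731761, 16, 251157);
  (7620026309257997, 2143, 5588440929032683); (198977, 16, 187584);
  (64326257, 16, 9287702); (5349901, 17, 1414164); (90556709, 647, 13136413);
  (50993, 16, 47180); (1952893, 17, 811626); (1185329, 16, 1111798);
  (73052897, 16, 1897872); (1145057, 16, 922018); (2555057, 16, 2028969);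
  (251369809, 16, 170577826);
  (36963203544432836071517, 17, 8155544954485006381943);
  (10476577, 16, 860820); (4139852641, 16, 2025128704);
  (669984017, 16, 357690459); (14897252478889094441, 17, 11035938998198090326);
  (4091, 409, 1024); (2196431308501, 4091, 301475384732);
  (596061121, 16, 72329408);
  (372175847916810649, 596061121, 238341984196456370);
  (17656084793233, 16, 13218250993359); (23769233, 16, 7548320);
  (603761, 16, 121577); (72539134561, 16, 46777305628);
  (56361201130181, 613, 33557625508515); (855103033, 673, 313772761);
  (44711, 17, 12521); (24378941017, 44711, 12986913108);
  (31248353950337, 16, 4416065658806); (516053, 17, 422379);
  (852881, 16, 535929); (20119441, 16, 6722741);
  (2434616217281, 16, 2182437622994); (558469243, 81, 71408500);
  (346185031289327, 558469243, 46612579472143);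
  (2856068050340702469241, 346185031289327, 2236946675705829943243);
  (611441, 16, 201604); (9104882209, 16, 3588171944);
  (76648633, 1249, 30680385); (5821, 97, 3612);
  (313043204893, 5821, 203105965830);
  (949488190418326609, 16, 228466078456368980); (493121, 16, 234020);
  (34751966101, 17, 17906361981); (2113014777089, 16, 1862802814599);
  (10003945456513, 16, 283247825785); (30468577, 16, 25821859);
  (3345841, 16, 3307059); (82046254421, 17, 16179650932);
  (294407497, 17, 97433918); (4241918099, 17, 591630665);
  (140594438891359129, 4241918099, 130152751256151390);
  (1350532609, 16, 980298372); (5826173, 17, 491936); (1496641, 16, 1191112);
  (753769278427829, 17, 749136432975528); (19841, 16, 16347);
  (1455278223821, 19841, 518774703962); (18745393, 16, 18012450);
  (35208160609, 16, 7255628721); (19724653409, 16, 9496133283);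
  (126257, 16, 71478); (13642561, 16, 7763140); (1235473, 16, 103866);
  (117137666077, 1235473, 100102361540); (639012113, 16, 147906207);
  (69661, 81, 39937); (24272400197, 69661, 334799290); (9797773, 103, 7120865);
  (4515977939283286753, 16, 4125077861033109465); (116089777, 16, 27177061);
  (125803, 241, 52919); (503213, 125803, 16);
  (496004976989, 503213, 78823161223); (127217, 16, 62779);
  (211028593, 16, 194948553); (1704043657, 81, 542551708);
  (544613, 17, 451865); (2050817, 16, 1993311); (163866977, 16, 38211302);
  (24204612193, 16, 9819741909); (41421841, 16, 32658970);
  (836557347848490947233, 16, 397020773044592476180); (4545521, 16, 534718);
  (736528657, 16, 165568774); (151729729, 16, 127504693);
  (58428622433, 16, 4267159342); (32244044745288737, 16, 11100583020101778);
  (172801, 16, 160600); (5658887149, 172801, 1250062667);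
  (11990401, 16, 11115924);
  (2761094992526189749, 11990401, 1689351300983851584);
  (13781041, 16, 11988950); (58853990557, 81, 33784633096);
  (3951841, 16, 950518); (33886099933106033, 16, 2059768741663918);
  (14804429, 449, 3404285); (10359105517, 17, 3328055419);
  (2504727814657, 16, 2225181150898); (132689, 16, 11341);
  (2127617, 16, 1905060); (9402317795442769, 16, 6112605888105377);
  (133463762737, 16, 29392117346); (28989013, 17, 280776);
  (44524789031547953, 16, 39597358048919510); (4428337, 16, 154722);
  (16782001, 16, 16422007); (1239416333, 479, 823524327); (571541, 17, 83780);
  (132411973539088193, 16, 27428125957379382); (674321, 16, 660359);
  (124824125057, 16, 30040884398); (7362049, 16, 5423844);
  (681000634469893, 7362049, 254266094324068);
  (23528569104401, 16, 3196586045826); (71129, 17, 21349);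
  (2416963421, 71129, 1490252654); (24642733, 241, 14936966);
  (88775569, 16, 39942797); (39257881121, 16, 28603486296);
  (94229624317943381895097, 39257881121, 88379527344011139510638);
  (42735577981, 163, 7930295403); (1890739537, 16, 114319360);
  (2050077708241, 16, 221185987919); (957937, 16, 327610);
  (15586729, 227, 2646487); (236176849, 16, 34547528); (4001, 16, 2135);
  (412855189, 4001, 59113253); (7433, 929, 256);
  (74323515777853, 7433, 52546067403846); (10338001, 16, 3518804);
  (168714209, 16, 88626696); (10657, 16, 8770); (368178037, 10657, 33259902);
  (123330154897, 16, 24168628366); (61180422690140749, 81, 29999952418920501);
  (1225849153, 16, 1135020303); (694481, 16, 643046); (278177, 16, 136664);
  (169659366350425828433, 16, 45210714635428007875); (26497, 16, 14433);
  (52193849423341, 26497, 38868385513961); (117652177, 16, 99870077);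
  (3208933380027958613, 117652177, 2788287428149525559);
  (847490209, 16, 133806359); (139409, 16, 6923); (1304481617, 16, 1103521658);
  (71914313, 1031, 50121061);
  (74023863979452340621, 353, 52601731122231011863);
  (17021873761, 16, 6793950914); (124225313857, 16, 64363086428);
  (724581098257, 16, 338899283362); (4351409, 16, 3413797);
  (3932993, 16, 1605554); (1536673681, 16, 1101515813); (408337, 16, 43746);
  (286362988265296650601, 408337, 277782163182189268060);
  (36506549, 17, 24478362); (43601137, 16, 11559207); (3302851, 97, 2048138);
  (6409578707621, 3302851, 4517294388350);
  (77677192891987009, 16, 73187337426493695); (2797440721, 16, 2310116791);
  (7155877621, 103, 7098697509); (945881, 17, 454500);
  (85153882907, 945881, 81158641177);
  (3020237918945477, 85153882907, 2472219797935245); (284129, 16, 273480);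
  (142193, 16, 68114); (15402677, 433, 12725828); (5651, 113, 2129);
  (201469453, 5651, 145890941); (347854803073, 16, 21007231403);
  (54076594409, 97, 45591172947); (570528337, 16, 201058284);
  (180286954493, 570528337, 72813239805);
  (140780886172407393769, 180286954493, 22358563229642954116);
  (4120753969, 16, 2433983789); (110365177772080793, 103, 76155056397422362);
  (147270447881, 97, 87401960965); (143569, 16, 41105);
  (18939832193, 16, 15699435891); (98836738635281, 16, 62515120516563);
  (5191489, 16, 4636339); (144241, 16, 1889); (676771, 17, 527593);
  (160898836330299469, 676771, 7810621572726951);
  (3049574870619113, 193, 1848238643683360); (1014161, 16, 617242);
  (53631931201, 16, 41208727009); (5449, 227, 5194); (48049283, 5449, 6950012);
  (5237179649869, 48049283, 2408579636720); (1295302961, 16, 692618347);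
  (155928833, 16, 145410607); (4316933897, 17, 3837258445);
  (5026638979, 433, 1767151431);
  (6525199203946518312707275277, 5026638979, 754856924618018697486508949);
  (45783750601, 17, 24723569405); (2273, 16, 764);
  (26936926070557, 2273, 25227091681393); (247796557, 17, 176353613);
  (146417, 16, 29712); (413711, 3761, 270794); (827423, 413711, 4);
  (151534248221, 827423, 107932591233); (7035649, 16, 6112152);
  (733841, 16, 111440); (169432393900280317, 257, 131029009717562782);
  (153288661, 17, 2872953); (4506313574202241, 16, 2280441390267440);
  (147377, 16, 73525); (1917137, 16, 1474567); (2641927153, 16, 1924967508);
  (26428231757, 17, 14111490618); (7439242801, 16, 5513941958);
  (6481, 16, 483); (64811, 6481, 1024); (16721239, 64811, 9972689);
  (1506270411651053, 16721239, 367563474651320);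
  (904847604304246913, 16, 684281017928416952);
  (953307548466761, 443, 281580974770627); (5102429, 137, 3022230);
  (13947209, 17, 4171915); (667639201, 16, 523761154); (4035313, 16, 3844476);
  (11743, 103, 1355); (63634612421, 11743, 48858300251);
  (952683629, 307, 4832701); (3290849, 16, 1627911); (43031633, 16, 2486633);
  (2715943921, 16, 1124398670); (5854679953, 16, 2056064827);
  (826370810400389, 647, 186006831414039); (29867, 137, 14596);
  (34010863011423414969373, 29867, 30789558856853507801156);
  (97443377, 16, 77677736); (709230968321, 16, 150714327147);
  (117698881, 16, 95207991); (11633, 16, 2406); (139597, 11633, 4096);
  (3293858684613858373, 139597, 1176018450383458177);
  (1130948120953201, 16, 661243489115191); (49598849, 16, 20120980);
  (3847, 641, 64); (39308184361, 3847, 2450366269); (15619, 137, 13921);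
  (44340779101, 15619, 30853639871); (340609913041, 16, 275144025931);
  (309178817, 16, 7530272); (4884847621, 113, 2134469913);
  (649323350537, 17, 70069904452);
  (29709983903340652854162637, 2273, 13361183926113766447263201);
  (2291281, 16, 2138275); (4546277, 17, 2886820);
  (14749182397, 3299, 6750870655); (612929, 16, 111220);
  (43318667761, 16, 7752374965); (22464135649, 16, 5412116113);
  (10551324109, 17, 8477707218);
  (812114314021513, 10551324109, 276849981804115); (73681109, 1913, 40081751);
  (7278724561, 16, 6638917527); (940423933, 81, 100855801); (75937, 16, 63735);
  (17614346521, 75937, 14710802116); (23537, 16, 18315); (141223, 23537, 64);
  (9856027170853, 141223, 135761641416); (66475373, 17, 49074517);
  (839067401, 433, 202763926); (3155437, 81, 2482287); (8033177, 103, 5593719);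
  (22002769, 16, 2462153); (17924869, 17, 5803466); (6833, 16, 352);
  (6764671, 6833, 1111325);
  (952368905318369091308933, 6764671, 88609753197180111262969);
  (9776230220881, 16, 3577368095268); (23339, 1667, 16384); (46679, 23339, 4);
  (4656718368568681, 46679, 2960643557566249); (8890229, 227, 718974);
  (671386138673, 16, 200295077172); (1098833, 16, 972772);
  (6771630577, 16, 3351516307); (134191877, 487, 14739190);
  (115079, 163, 31260); (1380949, 115079, 4096);
  (1469202688693, 1380949, 495761027873); (1895233, 16, 348774);
  (3483041, 16, 1622670); (2063, 1031, 4); (746807, 2063, 26433);
  (3107419118581, 746807, 979812454957); (951649, 16, 788263);
  (751438541408521, 3167, 323753616012508);
  (12527748861167314250760620761, 1601, 1109011414838868141781049589);
  (1620679, 17, 537382);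
  (3737826181425052996649, 1620679, 2295082641675341861282);
  (235064857, 227, 134546039); (159473, 16, 57753);
  (3235219633, 16, 1052448514); (140436235613, 17, 72401306226);
  (1437841, 16, 735913)].

(** The entries [(e, P)] assert that the certified number [P] divides
    [2 ^ e + 1]. *)
Definition roots : seq (N * N) := [::
  (4, 17); (14, 113); (22, 2113); (38, 525313); (50, 8101); (54, 246241);
  (58, 107367629); (74, 593); (78, 1249); (86, 500177); (90, 54001);
  (94, 3761); (106, 15358129); (118, 157649); (142, 148587949); (146, 9929);
  (166, 13063537); (178, 579017791994999956106149); (254, 26417);
  (262, 269665073); (278, 1408349); (298, 11011808951971745915313242336927641);
  (310, 37201); (366, 5080081); (382, 25212001); (394, 1079423677);
  (402, 3217); (414, 3313); (422, 18455044087121); (446, 95768689);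
  (474, 151681); (526, 99972364781); (538, 8609); (558, 140617);
  (562, 3827221); (598, 20333); (606, 12753877); (622, 21149); (626, 42569);
  (634, 344759057); (642, 1016929); (654, 5233); (662, 51861618869);
  (694, 5575597); (698, 157661163902833); (718, 585889);
  (734, 92525303484856757); (746, 6996402304983061); (766, 111650629);
  (794, 25409); (838, 53633); (842, 5442059869); (1018, 103837); (1042, 16673);
  (1046, 8369); (1058, 425654561); (1082, 1281089); (1094, 540893293);
  (1126, 133489553); (1138, 257189); (1142, 2384497); (1198, 86257);
  (1234, 2322817005065617); (1318, 1534153); (1322, 93405283373);
  (1382, 11057); (1402, 1649929681); (1478, 170756297); (1486, 260683037);
  (1522, 1567661); (1718, 41233); (1726, 12268162909); (1754, 178909);
  (1822, 29153); (1874, 546289747242387833); (1882, 25359946237);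
  (1934, 328781); (1982, 47569); (2038, 207877); (2066, 622097393);
  (2078, 47577889); (2102, 1513441); (2122, 49459577); (2126, 119057);
  (2174, 28221633169); (2182, 2070456161); (2186, 13155349); (2206, 525029);
  (3134, 75217); (3142, 127489793); (3194, 19362029); (3214, 668513);
  (3218, 5702297); (3238, 8392897); (3254, 494425777); (3314, 26513);
  (3326, 266081); (3338, 603008777268061313); (3386, 2748917329);
  (3442, 85967393); (3506, 6923494537); (3574, 1364821475654790269);
  (3578, 5796361); (3602, 23233706849); (3642, 29137); (3646, 58337);
  (3662, 46229089); (3694, 88657); (3722, 1949940913); (3758, 762355930500341);
  (3858, 308641); (3902, 46433801); (3926, 2426269); (3986, 1299437);
  (3998, 189513197); (5030, 44172232681); (5062, 4910141); (5078, 284369);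
  (5086, 137322001); (5098, 19698673); (5118, 1931185177); (5142, 93460993);
  (5234, 125617); (5266, 32059409); (5294, 18486649); (5326, 3321336209);
  (5342, 42737); (5354, 39175389329); (5366, 30468149); (5398, 25669713977);
  (5414, 62629153); (5422, 86753); (5438, 43014581); (5442, 370057);
  (5462, 305873); (5498, 236062129); (5534, 536178193); (5554, 2288249);
  (5570, 173628041); (5582, 14647169); (5606, 24229133); (5674, 346636009);
  (5854, 6743809); (5870, 126838961); (5898, 3845497); (5906, 566977);
  (5914, 8054869); (5926, 896781581); (5938, 95009); (5998, 12955681);
  (6002, 48017); (6022, 7220236266209); (6046, 290209); (6074, 2822832898049);
  (6098, 731761); (6166, 7620026309257997); (6218, 198977); (6238, 64326257);
  (6294, 5349901); (6362, 90556709); (6374, 50993); (6382, 1952893);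
  (6442, 1185329); (6458, 73052897); (6506, 1145057); (6518, 2555057);
  (6542, 251369809); (6602, 36963203544432836071517); (6614, 10476577);
  (6654, 4139852641); (6662, 669984017); (15014, 14897252478889094441);
  (15018, 2196431308501); (15034, 372175847916810649); (15058, 17656084793233);
  (15082, 23769233); (15094, 603761); (15102, 72539134561);
  (15110, 56361201130181); (15126, 855103033); (15146, 24378941017);
  (15154, 31248353950337); (15178, 516053); (15230, 852881); (15242, 20119441);
  (15262, 2434616217281); (15278, 2856068050340702469241); (15286, 611441);
  (15338, 9104882209); (15342, 76648633); (15374, 313043204893);
  (15406, 949488190418326609); (15410, 493121); (15434, 34751966101);
  (15446, 2113014777089); (15474, 10003945456513); (15482, 30468577);
  (15490, 3345841); (15514, 82046254421); (15518, 294407497);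
  (15546, 140594438891359129); (15562, 1350532609); (15578, 5826173);
  (15590, 1496641); (15626, 753769278427829); (15706, 1455278223821);
  (15726, 18745393); (15734, 35208160609); (15766, 19724653409);
  (15782, 126257); (15790, 13642561); (15802, 117137666077);
  (15814, 639012113); (15838, 24272400197); (15854, 9797773);
  (15866, 4515977939283286753); (15894, 116089777); (15898, 496004976989);
  (15902, 127217); (15958, 211028593); (15986, 1704043657); (16018, 544613);
  (16022, 2050817); (16078, 163866977); (16106, 24204612193);
  (16130, 41421841); (16174, 836557347848490947233); (16234, 4545521);
  (16246, 736528657); (16294, 151729729); (16318, 58428622433);
  (16342, 32244044745288737); (16374, 5658887149);
  (16382, 2761094992526189749); (16406, 13781041); (16438, 58853990557);
  (16466, 3951841); (16474, 33886099933106033); (16486, 14804429);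
  (16538, 10359105517); (16582, 2504727814657); (16586, 132689);
  (16622, 2127617); (16634, 9402317795442769); (16658, 133463762737);
  (16718, 28989013); (16754, 44524789031547953); (16774, 4428337);
  (16782, 16782001); (16802, 1239416333); (16810, 571541);
  (16846, 132411973539088193); (16858, 674321); (16862, 124824125057);
  (16886, 681000634469893); (16906, 23528569104401); (16990, 2416963421);
  (17042, 24642733); (17046, 88775569); (17054, 94229624317943381895097);
  (17058, 42735577981); (17078, 1890739537); (17090, 2050077708241);
  (17106, 957937); (17166, 15586729); (17174, 236176849); (17198, 412855189);
  (17222, 74323515777853); (17230, 10338001); (17258, 168714209);
  (17274, 368178037); (17294, 123330154897); (17322, 61180422690140749);
  (17326, 1225849153); (17362, 694481); (17386, 278177);
  (17398, 169659366350425828433); (17410, 52193849423341);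
  (17414, 3208933380027958613); (17418, 847490209); (17426, 139409);
  (17434, 1304481617); (17438, 71914313); (17454, 74023863979452340621);
  (17482, 17021873761); (17494, 124225313857); (17522, 724581098257);
  (17546, 4351409); (17558, 3932993); (17566, 1536673681);
  (17590, 286362988265296650601); (17602, 36506549); (17638, 43601137);
  (17642, 6409578707621); (17662, 77677192891987009); (17674, 2797440721);
  (17678, 7155877621); (17734, 3020237918945477); (17758, 284129);
  (17774, 142193); (17786, 15402677); (17826, 201469453);
  (17846, 347854803073); (17866, 54076594409); (17882, 140780886172407393769);
  (17902, 4120753969); (17938, 110365177772080793); (17942, 147270447881);
  (17946, 143569); (18002, 18939832193); (18014, 98836738635281);
  (18026, 5191489); (18030, 144241); (18058, 160898836330299469);
  (18098, 3049574870619113); (18110, 1014161); (18114, 53631931201);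
  (18166, 5237179649869); (18170, 1295302961); (18182, 155928833);
  (18206, 4316933897); (18218, 6525199203946518312707275277);
  (18234, 45783750601); (18254, 26936926070557); (18266, 247796557);
  (18302, 146417); (18314, 151534248221); (18322, 7035649); (18346, 733841);
  (18398, 169432393900280317); (18402, 153288661); (18406, 4506313574202241);
  (18422, 147377); (18434, 1917137); (18442, 2641927153); (18454, 26428231757);
  (18478, 7439242801); (18482, 1506270411651053); (18514, 904847604304246913);
  (18586, 953307548466761); (18622, 5102429); (18646, 13947209);
  (18670, 667639201); (18682, 4035313); (18686, 63634612421);
  (18694, 952683629); (18698, 3290849); (18742, 43031633); (18770, 2715943921);
  (18778, 5854679953); (18782, 826370810400389);
  (18806, 34010863011423414969373); (18826, 97443377); (18842, 709230968321);
  (18862, 117698881); (18866, 3293858684613858373); (18878, 1130948120953201);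
  (18902, 49598849); (18922, 39308184361); (18926, 44340779101);
  (18930, 340609913041); (18982, 309178817); (19010, 4884847621);
  (19022, 649323350537); (19058, 29709983903340652854162637); (19094, 2291281);
  (19102, 4546277); (19106, 14749182397); (19154, 612929);
  (19174, 43318667761); (19238, 22464135649); (19242, 812114314021513);
  (19258, 73681109); (19262, 7278724561); (19286, 940423933);
  (19330, 17614346521); (19354, 9856027170853); (19358, 66475373);
  (19378, 839067401); (19478, 3155437); (19498, 8033177); (19506, 22002769);
  (19526, 17924869); (19538, 952368905318369091308933); (19542, 9776230220881);
  (19574, 4656718368568681); (19582, 8890229); (19606, 671386138673);
  (19622, 1098833); (19658, 6771630577); (19682, 134191877);
  (19702, 1469202688693); (19742, 1895233); (19790, 3483041);
  (19814, 3107419118581); (19826, 951649); (19870, 751438541408521);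
  (19882, 12527748861167314250760620761); (19898, 3737826181425052996649);
  (19914, 235064857); (19934, 159473); (19938, 3235219633);
  (19946, 140436235613); (19970, 1437841)].

Definition candidates : seq N :=
  [:: 15122; 15182; 15206; 15214; 15754; 15758; 16358; 16574; 16778;
      16838; 16922; 17086; 17126; 17162; 17338; 17726; 18134;
      18418; 18934; 18958; 19078; 19226; 19322; 19718; 19802;
      19846; 19862].

Definition excluded : seq N := exponents (certified [::] chain) roots.

(** An element of order 343081 modulo [2 ^ 9533 + 1 - 2 ^ 4767], in base
    [2 ^ 256] with the least significant digit first. *)
Definition root_343081 : N := foldr (fun d x => d + pow2mul 256 x) 0 [::
  0x74a2e4fa63cc8c8a754530b99f5181cab6eb42742aacfc1365a740ae77644f89;
  0x7014ba76a07d4e04a9d24dac46ac5792dca86b690388ae3e80def21bad0af9a8;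
  0x23f0836722cbb3735e70bcbfb0915eeb166cd7124f1183f1e7faceb53ed64090;
  0x756f547d7366570febcc70f291bb7ce9efedc16f15d57fb61e8e5ebb6b151a61;
  0x663ff0378df337e8fad9bc5eeefc1b991e920d1e39c0dad5b21d396c8702178f;
  0x0ce64b211abea870d0be65b1846ccf8265beb33da1f5419318967724b336699e;
  0xfb6fd165f3a397f88c3603c2aacbb1a41ec5c61549d7446ab194d96b1a8846cb;
  0xab559637fd95b98b4abac37c112e050e42d8408dbfa9940fe7bb97f89d86b866;
  0x2a2a185e52088e483331a53fcdb9e447271905d8e056872899e87e54c12d75a5;
  0x119ef446b14ab9e7da0f1f0c808014be2975893cd9627171a69f5651f3c4ada5;
  0xda5cdeca2be3335e03f4b4ec26dc0b4971ad2d25a649726d762183c57425e202;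
  0x23b9c1f81710a62171378d90a2586c0b4fc97585ec2f184735000ee313c3aa89;
  0xb2e9cfc6cbc2edfa3cc47d558002442b3061944a6cac95f9341363d04168e731;
  0x011581ea8c4e95e5d457fa43e7fd417da04662ab51895f9d41060e8a45b24812;
  0x54668a3e1c051dd40cb332631a97b01013fda5d4a3c27622e16e26f3df5d06d3;
  0x093f13819f8342f35a98b42322170374e7da2b1183c8e5b0153fbea7376f95b4;
  0x6c7d75eee8d046c07d00b25b66211a167370ed2e404b98a37ec997b8ccfb676d;
  0x0277301fa60474816ca1ae6179f716d8018164d5fdf7087ffa19fb2554907ad2;
  0x641552346ed26daafb25477f9ee1595301183da520d3a97dda6bd5b249f83fe8;
  0xa7ef121321cddd79d3c3450d1db71a5f493bbfb35aa4aa2e704f943db0d324ca;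
  0xde07720768af086c9708d7578e7d9158f82369162000a5efc35fd49a158d8ca0;
  0x26eea93bec84fdb93997f9ac371c10849de408fc63d0cbc1a8fe5131c600f07a;
  0x1efa0ee1fdfecc42ed9e44157d2508775bd302d4843e3f95e94c2efd19f29ded;
  0xa510c28746bd0daab99df2ca4580cebd3ece2ea775d15df7422a2482e1aae8fd;
  0x412ccfe2bb0e2105a638b08a0b5d2db00667ef991158b0f2c3ab5b8b373eefd1;
  0x822067c960e87d2eb24fa9d22dbc99dfa91a1ff2282492a61cb89000993fe6e9;
  0x3a7b2c285ea3f6433dd33892c658d979a918798fa91a3a421937edf4beb2e879;
  0xf94d2a1b7ee566ba6940cf59898984094c67aecfc7de140f07422823edcc4c32;
  0xfbdb9c036a724aa6714800207044fea63835a9e79f72ca4b283ea656fcc2ed47;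
  0x52b32f4db136b3889668eede3f737e54e1bd576c2f67216ea32f12234b9508a8;
  0x8275c439fb177d967ea928cbdd03c516b2800b7d26ac617c9c052c4847b803e6;
  0xc562ef8dff81d81a281259f44c7bec5aa76df001ec823c4362332d941027a9d6;
  0xd3c8be3a7fab88dd6f454214d8b5df49cd16f5237739755d717390b2a8d9b9f1;
  0xdeeaf37c0eb958a65772b934a1e45e72fc330c0d912a07c8643317e9384ad2a2;
  0x491b78aad0e5f26428e9c16059ca1b78ef0767c10317b5f2280bb3e3ea19d826;
  0xeb1492afc14f3a4852740cda510312f5ca165830c429167c5390484d4c9f6747;
  0x575eb6a94ea66401051a1c216af977659ff3cb9f78806e1cfe8b6c6954fde948;
  0x0000000000000000000000000000000000000000000000000259b183ebaba371].

(** The half exponent 9533 is the one treated by [notinH_19066]. *)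
Definition candidate_or_excluded (j : N) : bool :=
  if has (N.eqb (2 * j)) candidates then true
  else if j =? 9533 then true else covered excluded (2 * j).

Local Close Scope N_scope.

(** * The range *)

Lemma certified_chain : sound (certified [::] chain).
Proof. by apply: certified_sound. Qed.

Lemma excluded_notinH m : covered excluded m -> ~ inH (N.to_nat m).
Proof. exact: (@coveredP (certified [::] chain) roots m certified_chain). Qed.

Lemma order_343081 : aurifeuille_ok 9533 4767 root_343081 343081.
Proof. by vm_cast_no_check (erefl true). Qed.

Lemma certified_343081 : has (N.eqb 343081) (certified [::] chain).
Proof. by vm_cast_no_check (erefl true). Qed.

Lemma notinH_19066 j : N.of_nat j = 9533%num -> ~ inH (2 * j).
Proof.
move=> jE.
have r_free : higgs_free (Pos.to_nat 343081).
  exact: (@certified_chain 343081%num certified_343081).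
suff -> : j = 9533 by apply: aurifeuille_notinH r_free order_343081.
by rewrite -(Nat2N.id j) jE; vm_cast_no_check (erefl 9533).
Qed.

Lemma sweep : all_range candidate_or_excluded 7501 2500.
Proof. by vm_cast_no_check (erefl true). Qed.

Lemma candidatesE :
  map N.to_nat candidates =
  [:: 15122; 15182; 15206; 15214; 15754; 15758; 16358; 16574; 16778;
      16838; 16922; 17086; 17126; 17162; 17338; 17726; 18134;
      18418; 18934; 18958; 19078; 19226; 19322; 19718; 19802;
      19846; 19862].
Proof. by vm_cast_no_check (erefl (map N.to_nat candidates)). Qed.

Theorem theorem14 (m : nat) :
  inHeven m -> 15000 < m <= 20000 ->
  m \in [:: 15122; 15182; 15206; 15214; 15754; 15758; 16358; 16574; 16778;
            16838; 16922; 17086; 17126; 17162; 17338; 17726; 18134;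
            18418; 18934; 18958; 19078; 19226; 19322; 19718; 19802;
            19846; 19862].
Proof.
move=> [mH /dvdnP[j mE]] m_range; rewrite -candidatesE.
have mN : m = N.to_nat (N.mul 2 (N.of_nat j)) by lia.
(* The literals of the statement are opaque to [lia]. *)
have to_nat15000 : 15000 = N.to_nat 15000 by vm_cast_no_check (erefl 15000).
have to_nat20000 : 20000 = N.to_nat 20000 by vm_cast_no_check (erefl 20000).
rewrite to_nat15000 to_nat20000 in m_range.
have j_range : N.to_nat 7501 <= j < N.to_nat 7501 + 2500 by lia.
have := all_rangeP sweep j_range; rewrite /candidate_or_excluded.
case: ifP => [/hasP[c c_cand /N.eqb_spec jc] _|_].
  by rewrite mN jc; apply: map_f.
case: N.eqb_spec => [/notinH_19066|_ j_cov]; first by rewrite mulnC -mE.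
have := @excluded_notinH (N.mul 2 (N.of_nat j)) j_cov.
by rewrite -mN.
Qed.
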